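(* Let $\sigma : \mathbb{R} \rightarrow \mathbb{R}$ be a weakly monotone continuous function and let $A$ be a $1 \times n$ real matrix. Then each equivalence class of $f = \sigma \circ A : \mathbb{R}^n \to \mathbb{R}$, $x \mapsto \sigma(Ax)$, is of dimension either $n$ or $n-1$.
   Context: The equivalence classes of $f$ are those of the relation on $\mathbb{R}^n$ defined by $p \sim q$ if and only if $f(p)=f(q)$. Weakly monotone means non-decreasing or non-increasing. Dimension is meant in the usual geometric sense for subsets of $\mathbb{R}^n$ (for instance, a hyperplane has dimension $n-1$, and a half-space, or the region between two parallel hyperplanes, has dimension $n$). Standing assumption in the paper: activation functions are almost-everywhere $\mathcal{C}^1$, that is, continuous, and $\mathcal{C}^1$ outside a set of measure zero. *)

(* Defs.v *)
From mathcomp Require Export all_boot all_order all_algebra.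
From mathcomp Require Export all_classical all_reals all_analysis.
Set Implicit Arguments.
Unset Strict Implicit.
Unset Printing Implicit Defensive.
Import Order.TTheory GRing.Theory Num.Theory.
Export numFieldNormedType.Exports.
Local Open Scope classical_set_scope.
Local Open Scope ring_scope.

Definition weakly_monotone (R : realType) (f : R -> R) : Prop :=
  {homo f : x y / x <= y} \/ {homo f : x y /~ x <= y}.

Definition equiv_class (T U : Type) (f : T -> U) (p : T) : set T :=
  [set q | f p = f q].

(* The dimension of an arbitrary subset is its Hausdorff dimension. The library
   norm on column vectors is the sup norm; Hausdorff dimension is invariant
   under bi-Lipschitz maps, so the Euclidean norm gives the same value. *)
Section hausdorff.
Variables (R : realType) (V : normedModType R).
Implicit Types (A : set V) (s delta : R).
Local Open Scope ereal_scope.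

(* [diam set0 = -oo], hence the separate case for set0 in [gauge]. *)
Definition diam A : \bar R :=
  ereal_sup [set `|x - y|%R%:E | x in A & y in A].

(* For s = 0 the power is 1 on every nonempty set, also one of diameter 0,
   so that the 0-dimensional measure is the counting measure. *)
Definition gauge s A : \bar R := if A == set0 then 0 else poweR (diam A) s.

Definition hausdorff_delta s delta A : \bar R :=
  ereal_inf [set \sum_(k <oo) gauge s (U k) | U in
    [set U : (set V)^nat |
      A `<=` \bigcup_k U k /\ forall k, diam (U k) <= delta%:E]].

Definition hausdorff_measure s A : \bar R :=
  ereal_sup [set hausdorff_delta s delta A | delta in
    [set delta | (0 < delta)%R]].

Definition hausdorff_dim A : \bar R :=
  ereal_inf [set s%:E | s in
    [set s | (0 <= s)%R /\ hausdorff_measure s A = 0]].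

End hausdorff.

(* Main.v *)
Require Import Defs.
From mathcomp Require Import lra.
Import Order.TTheory GRing.Theory Num.Theory.
Set Implicit Arguments.
Unset Strict Implicit.
Unset Printing Implicit Defensive.
Local Open Scope classical_set_scope.
Local Open Scope ring_scope.

(** The level sets of a weakly monotone function are order-convex
([weakly_monotone_const]), so the class of [p] is [{x | A x \in J}] for an
interval [J] containing [A p].  If [A = 0], the class is the whole space; if
[A <> 0] and [J] has two points, it contains a slab between two parallel
hyperplanes ([slab_contains_cube]).  In both cases it contains a cube, and its
dimension is [n] ([hausdorff_dim_cube]).  If [A <> 0] and [J] is a single point,
the class is a hyperplane; dropping a coordinate whose coefficient in [A] is not
[0] identifies it with [R^(n-1)] up to bi-Lipschitz equivalence
([hausdorff_dim_hyperplane]).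

Both dimensions come from the same two estimates on a set [E] with coordinates
[pi : V -> 'I_m -> R].

Upper bound ([hausdorff_dim_le_coord]): if the coordinates control distances in
[E], then [dim E <= m].  For [s > m], the part of [E] with coordinates in
[-j <= pi x i < j] is covered by [(2 j N)^m] pieces of diameter at most [L / N], whose
[s]-gauges sum to at most a constant times [N^(m - s)], which tends to [0];
[s]-null sets are stable under countable unions.

Lower bound ([hausdorff_dim_ge_coord]): if the coordinates are Lipschitz on [E]
and map [E] onto a set containing the unit cube, then [m <= dim E].  No measure
on [R^m] is used: a countable cover of [E] of small total gauge gives a cover of
the cube by open boxes, of which finitely many suffice by compactness, and
comparing the number of points of a fine grid in the cube with the numbers in
the boxes bounds the sum of the [m]-th powers of their radii from below
([unit_cube_cover_ge]). *)

(** * Covers and null sets *)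

Section upper_bound.
Variables (R : realType) (V : normedModType R).
Implicit Types (A E : set V) (s d e : R).

Lemma diam_le A d :
  (forall x y, A x -> A y -> `|x - y| <= d) -> (diam A <= d%:E)%E.
Proof.
move=> Ad; apply: ge_ereal_sup => _ [x Ax [y Ay <-]].
by rewrite lee_fin Ad.
Qed.

Lemma diam_ge A x y : A x -> A y -> (`|x - y|%:E <= diam A)%E.
Proof. by move=> Ax Ay; apply: ereal_sup_ubound; exists x => //; exists y. Qed.

Lemma diam_ge0 A : A !=set0 -> (0 <= diam A)%E.
Proof. by move=> [x Ax]; have := diam_ge Ax Ax; rewrite subrr normr0. Qed.

Lemma gauge_ge0 s A : (0 <= gauge s A)%E.
Proof. by rewrite /gauge; case: ifP => // _; exact: poweR_ge0. Qed.

Lemma gauge0 s : gauge s (set0 : set V) = 0%E.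
Proof. by rewrite /gauge eqxx. Qed.

Lemma gauge_le s A d : 0 <= s -> 0 <= d -> (diam A <= d%:E)%E ->
  (gauge s A <= (d `^ s)%:E)%E.
Proof.
move=> s0 d0 Ad; rewrite /gauge; case: ifPn => [_|/set0P A0].
  by rewrite lee_fin powR_ge0.
rewrite -poweR_EFin gt0_ler_poweR ?in_itv /= ?leey ?andbT ?lee_fin //.
exact: diam_ge0.
Qed.

(** Vanishing of [hausdorff_measure s A], freed of suprema and infima
([hausdorff_measure_eq0]). *)
Definition hausdorff_null s A := forall d e, 0 < d -> 0 < e ->
  exists U, [/\ A `<=` \bigcup_k U k, forall k, (diam (U k) <= d%:E)%E &
    (\sum_(k <oo) gauge s (U k) <= e%:E)%E].

Lemma hausdorff_measure_eq0 s A :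
  hausdorff_measure s A = 0%E <-> hausdorff_null s A.
Proof.
have ge0 d : (0 <= hausdorff_delta s d A)%E.
  apply: le_ereal_inf_tmp => _ [U _ <-].
  by apply: nneseries_ge0 => k _ _; exact: gauge_ge0.
split=> [A0 d e d0 e0|A0].
  have : (hausdorff_delta s d A < e%:E)%E.
    apply: (@le_lt_trans _ _ 0%E); last by rewrite lte_fin.
    by rewrite -A0; apply: ereal_sup_ubound; exists d.
  by move=> /ereal_inf_lt[_ [U [AU Ud] <-] /ltW Ue]; exists U.
apply/eqP; rewrite eq_le; apply/andP; split; last first.
  by apply: le_trans (ge0 1) _; apply: ereal_sup_ubound; exists 1 => /=.
apply: ge_ereal_sup => _ [d d0 <-]; apply/lee_addgt0Pr => e e0.
rewrite add0e; have [U [AU Ud Ue]] := A0 d e d0 e0.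
by apply: ge_ereal_inf; exists (\sum_(k <oo) gauge s (U k))%E => //; exists U.
Qed.

Lemma hausdorff_dim_le A (m : R) : 0 <= m ->
  (forall s, m < s -> hausdorff_null s A) -> (hausdorff_dim A <= m%:E)%E.
Proof.
move=> m0 Am; apply/lee_addgt0Pr => e e0; apply: ereal_inf_lbound.
exists (m + e) => //; split; first by rewrite addr_ge0 // ltW.
by apply/hausdorff_measure_eq0/Am; rewrite ltrDl.
Qed.

Lemma hausdorff_dim_ge A (m : R) :
  (forall s, 0 <= s -> hausdorff_null s A -> m <= s) ->
  (m%:E <= hausdorff_dim A)%E.
Proof.
move=> Am; apply: le_ereal_inf_tmp => _ [s [s0 /hausdorff_measure_eq0 As] <-].
by rewrite lee_fin Am.
Qed.

(** Choose for the [j]-th set a cover of total gauge [e / 2^(j+1)] and enumerate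
all the covers together along a bijection between [nat] and [nat * nat]. *)
Lemma hausdorff_null_bigcup s (E : (set V)^nat) :
  (forall j, hausdorff_null s (E j)) -> hausdorff_null s (\bigcup_j E j).
Proof.
move=> E0 d e d0 e0.
have [/= G PG] := choice (fun j =>
  E0 j d _ d0 (divr_gt0 e0 (exprn_gt0 j.+1 (@ltr0Sn R 1)))).
have [f bij_f] : exists f : nat -> nat * nat, set_bij setT setT f.
  exact/card_set_bijP/card_esym/card_nat2.
exists (fun k => G (f k).1 (f k).2); split.
- move=> x [j _ Ejx]; have [+ _ _] := PG j => /(_ _ Ejx)[i _ Gx].
  have [_ _ /(_ (j, i) I)[k _ fk]] := bij_f.
  by exists k => //; rewrite fk.
- by move=> k; have [] := PG (f k).1.
have g0 p : (0 <= gauge s (G p.1 p.2))%E by exact: gauge_ge0.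
rewrite nneseries_esumT; last by move=> k; exact: g0.
rewrite -(reindex_esum setT setT f (fun p => gauge s (G p.1 p.2)) bij_f).
have -> : [set: nat * nat] = setT `*`` (fun=> setT).
  by apply/seteqP; split.
rewrite -(esum_esum (a := fun j i => gauge s (G j i))); last first.
  by move=> *; exact: gauge_ge0.
rewrite (_ : esum _ _ = \sum_(j <oo) \sum_(i <oo) gauge s (G j i))%E; last first.
  rewrite nneseries_esumT; last first.
    by move=> j; apply: nneseries_ge0 => i _ _; exact: gauge_ge0.
  apply: eq_esum => j _; rewrite nneseries_esumT // => i; exact: gauge_ge0.
have := @epsilon_trick R (fun=> 0%E) e xpredT (fun=> lexx _) (ltW e0).
rewrite [X in (_ <= X + _)%E -> _]eseries0 // add0e; apply: le_trans.
apply: lee_nneseries => [j _ _|j _].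
  by apply: nneseries_ge0 => i _ _; exact: gauge_ge0.
by rewrite /= add0e natrX; have [] := PG j.
Qed.

Lemma hausdorff_nullS s A E : A `<=` E -> hausdorff_null s E ->
  hausdorff_null s A.
Proof.
move=> AE E0 d e d0 e0; have [U [EU Ud Ue]] := E0 d e d0 e0.
by exists U; split=> //; exact: subset_trans EU.
Qed.

(** The empty sets that pad a finite cover to a sequence have gauge [0] for every
[s], also for [s = 0]. *)
Lemma hausdorff_null_fin s A :
  (forall d e, 0 < d -> 0 < e -> exists (T : finType) (U : T -> set V),
    [/\ A `<=` \bigcup_t U t, forall t, (diam (U t) <= d%:E)%E &
      (\sum_t gauge s (U t) <= e%:E)%E]) ->
  hausdorff_null s A.
Proof.
move=> Afin d e d0 e0; have [T [U [AU Ud Ue]]] := Afin d e d0 e0.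
pose W := nth set0 [seq U t | t <- enum T].
have W0 k : (#|T| <= k)%N -> W k = set0.
  by move=> Tk; rewrite /W nth_default // size_map -cardE.
exists W; split.
- move=> x /AU[t _ Utx]; exists (index t (enum T)) => //.
  by rewrite /W (nth_map t) ?nth_index ?index_mem ?mem_enum.
- move=> k; have [kT|/W0 ->] := ltnP k #|T|; last by apply: diam_le.
  have [t _] : exists t : T, true by exists (enum_val (Ordinal kT)).
  by rewrite /W (nth_map t) -?cardE //; exact: Ud.
apply: le_trans Ue; rewrite (nneseries_split 0 #|T|); last first.
  by move=> k _; exact: gauge_ge0.
rewrite add0n [X in (_ + X)%E]eseries0 ?adde0; last first.
  by move=> k Tk _; rewrite W0 // gauge0.
have -> : (\sum_t gauge s (U t) =
    \sum_(X <- [seq U t | t <- enum T]) gauge s X)%E by rewrite big_map big_enum.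
by rewrite (big_nth set0) size_map -cardE.
Qed.

(** * Upper bound for the dimension *)

(** Grid argument: at mesh [1 / N], the part of [E] with [-j <= pi x i < j] for
all [i] splits into [(2 j N)^m] cells, each of diameter at most [L / N].  As
[m < s], their total gauge tends to [0] with the mesh. *)
Lemma hausdorff_dim_le_coord m (pi : V -> 'I_m -> R) (L : R) E :
  0 <= L ->
  (forall x y d, E x -> E y -> 0 <= d ->
    (forall i, `|pi x i - pi y i| <= d) -> `|x - y| <= L * d) ->
  (hausdorff_dim E <= m%:R%:E)%E.
Proof.
move=> L0 EL; apply: hausdorff_dim_le => // s ms.
pose B j := E `&` [set x | forall i, - j%:R <= pi x i < j%:R].
apply: (@hausdorff_nullS _ _ (\bigcup_j B j)) => [x Ex|].
  exists (\max_i (Num.bound (pi x i))) => //; split=> // i.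
  have : `|pi x i| < (\max_i (Num.bound (pi x i)))%:R.
    by apply: lt_le_trans (unstable.ltr_norm_bound _) _; rewrite ler_nat leq_bigmax.
  by rewrite ltr_norml => /andP[/ltW -> ->].
apply: hausdorff_null_bigcup => j; apply: hausdorff_null_fin => d e d0 e0.
have sm0 : 0 < s - m%:R by rewrite subr_gt0.
have s0 : 0 <= s by apply: le_trans (ltW ms).
pose C := (j.*2)%:R ^+ m * L `^ s.
have C0 : 0 <= C by rewrite mulr_ge0 ?powR_ge0 ?exprn_ge0.
(* With [C] as above, the total gauge at mesh [1 / N] is [C / N^(s - m)]. *)
pose N := (Num.bound (L / d) + Num.bound ((C / e) `^ (s - m%:R)^-1)).+1.
have N0 : 0 < N%:R :> R by rewrite ltr0n.
have LN : L / N%:R <= d.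
  rewrite ler_pdivrMr // mulrC -ler_pdivrMr //.
  apply: ltW (lt_le_trans (unstable.ltr_bound _) _).
  by rewrite ler_nat /N -addSn leqW // leq_addr.
have CN : C / N%:R `^ (s - m%:R) <= e.
  rewrite ler_pdivrMr ?powR_gt0 // mulrC -ler_pdivrMr //.
  have CE : C / e = ((C / e) `^ (s - m%:R)^-1) `^ (s - m%:R).
    by rewrite -powRrM mulVf ?gt_eqF // powRr1 // divr_ge0 // ltW.
  rewrite [leLHS]CE ge0_ler_powR ?nnegrE ?powR_ge0 //; first exact: ltW.
  apply: ltW (lt_le_trans (unstable.ltr_bound _) _).
  by rewrite ler_nat /N leqW // leq_addl.
pose U (f : {ffun 'I_m -> 'I_(j.*2 * N)}) := B j `&`
  [set x | forall i, Num.truncn ((pi x i + j%:R) * N%:R) = f i].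
have Udiam f : (diam (U f) <= (L / N%:R)%:E)%E.
  apply: diam_le => x y [[Ex Bx] xf] [[Ey By] yf].
  apply: EL => // i.
  have /andP[x1 x2] := Bx i; have /andP[y1 y2] := By i.
  have /truncn_itv : 0 <= (pi x i + j%:R) * N%:R by apply: mulr_ge0 => //; lra.
  have /truncn_itv : 0 <= (pi y i + j%:R) * N%:R by apply: mulr_ge0 => //; lra.
  rewrite (xf i) (yf i) -natr1 => /andP[yl yu] /andP[xl xu].
  rewrite -[leRHS]mul1r ler_pdivlMr // -[X in _ * X]gtr0_norm // -normrM.
  by rewrite ler_norml; apply/andP; split; lra.
exists {ffun 'I_m -> 'I_(j.*2 * N)}, U; split.
- move=> x [Ex Bx].
  have lt i : (Num.truncn ((pi x i + j%:R) * N%:R) < j.*2 * N)%N.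
    have /andP[x1 x2] := Bx i.
    rewrite truncn_lt_nat; last by apply: mulr_ge0 => //; lra.
    by rewrite natrM ltr_pM2r // -addnn natrD; lra.
  by exists [ffun i => Ordinal (lt i)] => //; split=> // i; rewrite ffunE.
- by move=> f; apply: le_trans (Udiam f) _; rewrite lee_fin.
apply: (@le_trans _ _
    (\sum_(f : {ffun 'I_m -> 'I_(j.*2 * N)}) ((L / N%:R) `^ s)%:E)%E).
  by apply: lee_sum => f _; apply: gauge_le; rewrite ?divr_ge0.
rewrite sumEFin lee_fin sumr_const card_ffun !card_ord.
apply: le_trans CN; rewrite -[leLHS]mulr_natl.
rewrite powRM ?invr_ge0 // -powR_inv1 // -powRrM mulN1r.
rewrite natrX natrM exprMn /C -!mulrA ler_wpM2l ?exprn_ge0 // mulrCA.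
rewrite ler_wpM2l ?powR_ge0 // -powR_mulrn // -powRD ?(gt_eqF N0) ?implybT //.
by rewrite -powRN opprB.
Qed.

End upper_bound.

(** * Lower bound for the dimension *)

Lemma card_narrow N (P : pred 'I_N) (b : nat) :
  (forall i j, P i -> P j -> (j <= i + b)%N) -> (#|P| <= b.+1)%N.
Proof.
move=> Pb; have [i Pi|P0] := pickP P; last by rewrite (eq_card0 P0).
case: (arg_minnP (fun j : 'I_N => nat_of_ord j) Pi) => a Pa amin.
rewrite cardE -(size_map val) -(size_iota a b.+1).
apply: uniq_leq_size; first by rewrite (map_inj_uniq val_inj) enum_uniq.
move=> _ /mapP[j + ->]; rewrite mem_enum => Pj.
by rewrite mem_iota amin //= addnS ltnS Pb.
Qed.

Section lower.
Variable R : realType.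

(** An interval of length [2 r] has at most [2 N r + 1] points of the grid of mesh
[1 / N]; the hypothesis on [N] absorbs the additive constant. *)
Lemma card_grid_box N m (c : 'I_m -> R) (r : R) : 1 <= N%:R * r ->
  #|[pred f : {ffun 'I_m -> 'I_N} | [forall i, `|(f i)%:R / N%:R - c i| < r]]|%:R
    <= (3 * (N%:R * r)) ^+ m.
Proof.
move=> Nr.
have N0 : 0 < N%:R :> R.
  by rewrite ltr0n; case: N Nr => // ; rewrite mul0r ler10.
pose F i := [pred j : 'I_N | `|j%:R / N%:R - c i| < r].
rewrite (@eq_card _ _ (family F)); last first.
  by move=> f; rewrite !inE.
rewrite card_family foldrE big_map big_enum /= natr_prod.
apply: (@le_trans _ _ (\prod_(i < m) (3 * (N%:R * r)))); last first.
  by rewrite prodr_const card_ord.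
apply: ler_prod => i _; rewrite ler0n /=.
have : (#|F i| <= (Num.truncn (2 * (N%:R * r))).+1)%N.
  apply: card_narrow => j k /=; rewrite !ltr_distl => /andP[j1 j2] /andP[k1 k2].
  have : (k%:R - j%:R) / N%:R <= 2 * r by rewrite mulrBl; lra.
  rewrite ler_pdivrMr // => kj.
  have : k%:R - j%:R < (Num.truncn (2 * (N%:R * r))).+1%:R :> R.
    by apply: le_lt_trans (truncnS_gt _); lra.
  by rewrite ltrBlDl -natrD ltr_nat addnS ltnS.
rewrite -(ler_nat R) => /le_trans; apply.
have : (Num.truncn (2 * (N%:R * r)))%:R <= 2 * (N%:R * r) by rewrite truncn_le; lra.
by rewrite -natr1; lra.
Qed.

(** The [N^m] points of the grid [{0, 1/N, ..., (N-1)/N}^m] lie in the cube, and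
the box of radius [r k] contains at most [(3 N r k)^m] of them once
[N >= 1 / r k]; divide by [N^m]. *)
Lemma unit_cube_cover_ge m n (c : nat -> 'I_m -> R) (r : nat -> R) :
  (forall k, 0 < r k) ->
  (forall t : 'I_m -> R, (forall i, 0 <= t i <= 1) ->
    exists2 k, (k < n)%N & forall i, `|t i - c k i| < r k) ->
  1 <= \sum_(k < n) (3 * r k) ^+ m.
Proof.
move=> r0 cov.
pose N := (\max_(k < n) Num.bound (r k)^-1).+1.
have N0 : 0 < N%:R :> R by rewrite ltr0n.
have Nr (k : 'I_n) : 1 <= N%:R * r k.
  rewrite -ler_pdivrMr // mul1r; apply: ltW (lt_le_trans (unstable.ltr_bound _) _).
  by rewrite ler_nat /N leqW // (leq_bigmax k).
pose G (k : 'I_n) := [pred f : {ffun 'I_m -> 'I_N} |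
  [forall i, `|(f i)%:R / N%:R - c k i| < r k]].
have : (N ^ m <= \sum_(k < n) #|G k|)%N.
  have -> : (N ^ m = \sum_(f : {ffun 'I_m -> 'I_N}) 1)%N.
    by rewrite sum1_card card_ffun !card_ord.
  have cG (k : 'I_n) : #|G k| = (\sum_f (f \in G k))%N.
    by rewrite -sum1_card big_mkcond; apply: eq_bigr => f _; case: ifP.
  rewrite (eq_bigr _ (fun k _ => cG k)) exchange_big /=; apply: leq_sum => f _.
  have [i|k kn fk] := cov (fun i => (f i)%:R / N%:R).
    by rewrite divr_ge0 //= ler_pdivrMr // mul1r ler_nat ltnW.
  have Gf : f \in G (Ordinal kn) by rewrite inE; apply/forallP.
  by rewrite (bigD1 (Ordinal kn)) //= Gf.
rewrite -(ler_nat R) natrX natr_sum => NG.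
rewrite -(@ler_pM2l _ (N%:R ^+ m)) ?exprn_gt0 // mulr1 (le_trans NG) //.
rewrite mulr_sumr; apply: ler_sum => k _.
by apply: le_trans (card_grid_box _ (Nr k)) _; rewrite -exprMn mulrCA.
Qed.

Lemma unit_cube_subcover m (c : nat -> 'I_m -> R) (r : nat -> R) :
  (forall k, 0 < r k) ->
  (forall t : 'I_m -> R, (forall i, 0 <= t i <= 1) ->
    exists k, forall i, `|t i - c k i| < r k) ->
  exists n, forall t : 'I_m -> R, (forall i, 0 <= t i <= 1) ->
    exists2 k, (k < n)%N & forall i, `|t i - c k i| < r k.
Proof.
move=> r0 cov.
pose Q := [set v : 'rV[R]_m | forall i, `[0, 1]%classic (v ord0 i)].
pose F k : set 'rV[R]_m := ball (\row_i c k i) (r k).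
have : compact Q.
  apply: (@rV_compact R m (fun=> `[0, 1]%classic)) => i; exact: segment_compact.
rewrite compact_cover => Qcov.
have [D _ QD] : finite_subset_cover setT F Q.
  apply: Qcov => [k _|v Qv]; first exact: ball_open.
  have [i|k vk] := cov (v ord0); first by have := Qv i; rewrite /= in_itv.
  by exists k => //; split=> // a i; rewrite ord1 !mxE; have := vk i; rewrite distrC.
exists (\max_(k <- finmap.enum_fset D) k).+1 => t t01.
have [i|k /= kD [_ tk]] := QD (\row_i t i); first by rewrite mxE /= in_itv; exact: t01.
exists k.
  by rewrite ltnS; apply: (@leq_bigmax_seq _ (finmap.enum_fset D) xpredT id).
by move=> i; have := tk ord0 i; rewrite !mxE distrC.
Qed.

Variable V : normedModType R.
Implicit Types (A E : set V) (s d e : R).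

(** The powers of a number in [0, 1] decrease with the exponent.  The number [d]
stands for the diameter, which is [-oo] on the empty set. *)
Lemma gauge_ge_expr s m A : 0 <= s -> s <= m.+1%:R -> (diam A <= 1)%E ->
  exists d, [/\ 0 <= d, forall x y, A x -> A y -> `|x - y| <= d &
    ((d ^+ m.+1)%:E <= gauge s A)%E].
Proof.
move=> s0 sm A1; have [->|A0] := eqVneq A set0.
  by exists 0; split=> //; rewrite expr0n gauge0.
have /set0P/diam_ge0 dA0 := A0.
have dAE : diam A = (fine (diam A))%:E.
  by rewrite fineK // ge0_fin_numE // (le_lt_trans A1) ?ltry.
move: dA0 A1; rewrite /gauge (negbTE A0) dAE !lee_fin => d0 d1.
exists (fine (diam A)); split => //.
  by move=> x y Ax Ay; rewrite -lee_fin -dAE diam_ge.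
rewrite poweR_EFin lee_fin.
have [->|dn0] := eqVneq (fine (diam A)) 0; first by rewrite expr0n powR_ge0.
by rewrite -powR_mulrn // ger_powR // lt_neqAle eq_sym dn0 d0.
Qed.

Lemma sum_halves_le n e : 0 <= e -> \sum_(k < n) e / 2 ^+ k.+1 <= e.
Proof.
move=> e0; suff -> : \sum_(k < n) e / 2 ^+ k.+1 = e - e / 2 ^+ n.
  by rewrite gerBl divr_ge0 // exprn_ge0.
elim: n => [|n IH]; first by rewrite big_ord0 expr0 divr1 subrr.
rewrite big_ord_recr /= IH exprS invfM.
by lra.
Qed.

(** If [s < m] and [E] is [s]-null, cover [E] by sets [U k] of diameter at most
[1] and of total gauge at most [e].  The coordinates map each
[E `&` U k] into an open box of radius [r k], and the boxes cover the cube; but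
[\sum_k (3 r k)^m <= 6^m (L^m + 1) e], which contradicts [unit_cube_cover_ge]
once [e] is small. *)
Lemma hausdorff_dim_ge_coord m (pi : V -> 'I_m -> R) (L : R) E : 0 <= L ->
  (forall x y i, E x -> E y -> `|pi x i - pi y i| <= L * `|x - y|) ->
  (forall t : 'I_m -> R, (forall i, 0 <= t i <= 1) ->
    exists2 x, E x & forall i, pi x i = t i) ->
  (m%:R%:E <= hausdorff_dim E)%E.
Proof.
move=> L0 EL Epi; apply: hausdorff_dim_ge => s s0 Es.
rewrite leNgt; apply/negP => sm.
case: m => [|m] in pi EL Epi sm *; first by have := lt_le_trans sm s0; rewrite ltxx.
pose M : R := 6 ^+ m.+1 * (L ^+ m.+1 + 1).
have M1 : 1 <= M.
  by rewrite mulr_ege1 ?exprn_ege1 ?lerDr ?exprn_ge0 // ler1n.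
pose e := (2 * M)^-1.
have e0 : 0 < e by rewrite invr_gt0; lra.
have e1 : e <= 1 by rewrite invf_le1; lra.
have [U [EU U1 Ue]] := Es 1 e ltr01 e0.
have [D /all_and3[D0 UD DU]] := choice (fun k => gauge_ge_expr s0 (ltW sm) (U1 k)).
(* When [E `&` U k] is empty, [c k] is arbitrary: the [k]-th box then covers
   nothing that matters and only enters the sum. *)
have [c Uc] : {c : nat -> V & forall k x, (E `&` U k) x -> (E `&` U k) (c k)}.
  apply: (@choice _ _ (fun k y => forall x, (E `&` U k) x -> (E `&` U k) y)) => k.
  have [[y yk]|/forallNP no] := pselect (exists y, (E `&` U k) y); first by exists y.
  by exists 0 => x /no.
pose eta k := e / 2 ^+ k.+1.
have eta0 k : 0 < eta k by rewrite divr_gt0 // exprn_gt0.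
have eta1 k : eta k <= 1.
  apply: le_trans e1; rewrite ler_pdivrMr ?exprn_gt0 // ler_peMr ?(ltW e0) //.
  by rewrite exprn_ege1 // ler1n.
(* The image of [E `&` U k] lies in the closed box of radius [L * D k] around
   [pi (c k)].  The open box of radius [r k] contains it, also when [D k = 0],
   and the terms [eta k] add little to the sum. *)
pose r k := 2 * Num.max (L * D k) (eta k).
have r0 k : 0 < r k by rewrite mulr_gt0 // lt_max eta0 orbT.
have Dr k : L * D k < r k.
  have := eta0 k; rewrite /r; have [|] := leP (L * D k) (eta k); lra.
have [t t01|n cov] := @unit_cube_subcover m.+1 (pi \o c) r r0.
  have [x Ex xt] := Epi t t01; have [k _ Ukx] := EU x Ex.
  have [Ec Ukc] := Uc k x (conj Ex Ukx).
  exists k => i /=; rewrite -xt (le_lt_trans (EL _ _ _ Ex Ec)) //.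
  by rewrite (le_lt_trans _ (Dr k)) // ler_wpM2l // UD.
have := unit_cube_cover_ge r0 cov; apply/negP; rewrite -ltNge.
have sumD : \sum_(k < n) D k ^+ m.+1 <= e.
  rewrite -lee_fin -sumEFin; apply: le_trans Ue.
  apply: (@le_trans _ _ (\sum_(0 <= k < n) gauge s (U k))%E).
    by rewrite big_mkord; apply: lee_sum => k _; exact: DU.
  by apply: nneseries_lim_ge => k _ _; exact: gauge_ge0.
apply: (@le_lt_trans _ _ (\sum_(k < n)
    (6 ^+ m.+1 * (L ^+ m.+1 * D k ^+ m.+1 + eta k)))).
  apply: ler_sum => k _.
  rewrite /r mulrA -natrM exprMn ler_wpM2l ?exprn_ge0 // -exprMn.
  have LD0 : 0 <= L * D k by rewrite mulr_ge0.
  have [_|_] := leP (L * D k) (eta k).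
    apply: (@le_trans _ _ (eta k)); last by rewrite lerDr exprn_ge0.
    by rewrite exprS ler_piMr ?exprn_ile1 // ltW.
  by rewrite lerDl ltW.
rewrite -mulr_sumr big_split /= -mulr_sumr.
apply: (@le_lt_trans _ _ (M * e)); last first.
  by rewrite /e invfM mulrCA divff ?mulr1 ?invf_lt1 ?ltr1n ?gt_eqF //; lra.
rewrite /M -mulrA ler_wpM2l ?exprn_ge0 // mulrDl mul1r lerD //.
  by rewrite ler_wpM2l ?exprn_ge0.
exact: sum_halves_le (ltW e0).
Qed.

End lower.

(** * Cubes, hyperplanes and slabs *)

Section affine.
Variable R : realType.

Lemma mx_coord_le m n (x : 'M[R]_(m, n)) i j : `|x i j| <= `|x|.
Proof.
rewrite [leRHS]/Num.norm /= mx_normrE.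
by apply/bigmax_geP; right; exists (i, j).
Qed.

Lemma mx_norm_le m n (x : 'M[R]_(m, n)) d : 0 <= d ->
  (forall i j, `|x i j| <= d) -> `|x| <= d.
Proof.
move=> d0 xd; rewrite [leLHS]/Num.norm /= mx_normrE.
by apply: bigmax_le => // -[i j] _; exact: xd.
Qed.

(** The coordinates of the whole space bound the dimension from above; the same
coordinates, translated and rescaled so that the given cube becomes the unit
cube, bound it from below. *)
Lemma hausdorff_dim_cube n (E : set 'cV[R]_n) (q : 'cV[R]_n) (r : R) :
  0 < r ->
  (forall t : 'cV[R]_n, (forall i, 0 <= t i ord0 <= 1) -> E (q + r *: t)) ->
  hausdorff_dim E = n%:R%:E.
Proof.
move=> r0 Eq; apply/eqP; rewrite eq_le; apply/andP; split.
  apply: (@hausdorff_dim_le_coord _ _ n (fun (x : 'cV_n) i => x i ord0) 1) => //.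
  move=> x y d _ _ d0 xyd; rewrite mul1r; apply: mx_norm_le => // i j.
  by rewrite ord1 !mxE; exact: xyd.
apply: (@hausdorff_dim_ge_coord _ _ n
  (fun (x : 'cV_n) i => (x i ord0 - q i ord0) / r) r^-1).
- by rewrite invr_ge0 ltW.
- move=> x y i _ _; rewrite -mulrBl opprB addrA subrK normrM mulrC.
  rewrite gtr0_norm ?invr_gt0 // ler_wpM2l ?invr_ge0 ?(ltW r0) //.
  by have := mx_coord_le (x - y) i ord0; rewrite !mxE.
- move=> t t01; exists (q + r *: \col_i t i); first by apply: Eq => i; rewrite mxE.
  by move=> i; rewrite !mxE [_ + r * _]addrC addrK mulrC mulKf // gt_eqF.
Qed.

Lemma row_mul_col n (A : 'M[R]_(1, n)) (x : 'cV[R]_n) :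
  (A *m x) ord0 ord0 = \sum_j A ord0 j * x j ord0.
Proof. by rewrite mxE. Qed.

(** The coordinates other than [i0] parametrize the hyperplane, because
[A ord0 i0 != 0] lets one solve its equation for the coordinate [i0]; the
solution is a Lipschitz function of the other coordinates. *)
Lemma hausdorff_dim_hyperplane m (A : 'M[R]_(1, m.+1)) i0 (c : R) :
  A ord0 i0 != 0 ->
  hausdorff_dim [set x : 'cV[R]_m.+1 | (A *m x) ord0 ord0 = c] = m%:R%:E.
Proof.
move=> Ai0; set E := [set x | _].
have AE (x : 'cV[R]_m.+1) : (A *m x) ord0 ord0 =
    A ord0 i0 * x i0 ord0 + \sum_j A ord0 (lift i0 j) * x (lift i0 j) ord0.
  by rewrite row_mul_col (bigD1_ord i0).
pose L := 1 + (\sum_j `|A ord0 (lift i0 j)|) / `|A ord0 i0|.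
have L1 : 1 <= L by rewrite lerDl divr_ge0 // sumr_ge0.
apply/eqP; rewrite eq_le; apply/andP; split.
  apply: (@hausdorff_dim_le_coord _ _ m
    (fun (x : 'cV_m.+1) j => x (lift i0 j) ord0) L).
    by apply: le_trans L1.
  move=> x y d Ex Ey d0 xyd; have Ld : d <= L * d by rewrite ler_peMl.
  apply: mx_norm_le => [|k a]; first exact: le_trans Ld.
  rewrite ord1 !mxE; case: (unliftP i0 k) => [j ->|->]; first exact: le_trans Ld.
  have xyE : A ord0 i0 * (x i0 ord0 - y i0 ord0) =
      \sum_j A ord0 (lift i0 j) * (y (lift i0 j) ord0 - x (lift i0 j) ord0).
    have := etrans Ex (esym Ey); rewrite !AE mulrBr => xy.
    by under eq_bigr do rewrite mulrBr; rewrite sumrB; lra.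
  rewrite mulrDl mul1r mulrAC -[leLHS]add0r lerD // ler_pdivlMr ?normr_gt0 //.
  rewrite -normrM mulrC xyE mulr_suml; apply: le_trans (ler_norm_sum _ _ _) _.
  by apply: ler_sum => j _; rewrite normrM ler_wpM2l // distrC.
apply: (@hausdorff_dim_ge_coord _ _ m
    (fun (x : 'cV_m.+1) j => x (lift i0 j) ord0) 1) => //.
  move=> x y j _ _; rewrite mul1r.
  by have := mx_coord_le (x - y) (lift i0 j) ord0; rewrite !mxE.
move=> t _.
pose x : 'cV[R]_m.+1 := \col_k
  if unlift i0 k is Some j then t j
  else (c - \sum_j A ord0 (lift i0 j) * t j) / A ord0 i0.
have xt j : x (lift i0 j) ord0 = t j by rewrite mxE liftK.
exists x => //; rewrite /E /= AE (eq_bigr _ (fun j _ => congr1 _ (xt j))).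
by rewrite mxE unlift_none mulrC divfK // subrK.
Qed.

Lemma weakly_monotone_const (sigma : R -> R) a b z : weakly_monotone sigma ->
  sigma a = sigma b -> a <= z <= b -> sigma z = sigma a.
Proof.
move=> mono ab /andP[az zb]; apply/eqP; rewrite eq_le.
by case: mono => mono; [rewrite {1}ab | rewrite {2}ab]; rewrite !mono.
Qed.

Lemma slab_contains_cube n (A : 'M[R]_(1, n)) i0 a b : A ord0 i0 != 0 -> a < b ->
  exists (q : 'cV[R]_n) (r : R), 0 < r /\
  forall t : 'cV[R]_n, (forall i, 0 <= t i ord0 <= 1) ->
    a <= (A *m (q + r *: t)) ord0 ord0 <= b.
Proof.
move=> Ai0 ab; pose S := \sum_j `|A ord0 j|.
have S0 : 0 <= S by apply: sumr_ge0.
(* [q] is a multiple of a basis vector on which [A] takes the middle value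
   [(a + b) / 2]; the [1] in [1 + S] avoids dividing by zero. *)
exists (((a + b) / 2 / A ord0 i0) *: delta_mx i0 ord0), ((b - a) / 2 / (1 + S)).
split=> [|t t01]; first by rewrite !divr_gt0 //; lra.
rewrite mulmxDr -!scalemxAr !mxE.
have -> : \sum_j A ord0 j * (delta_mx i0 ord0 : 'cV[R]_n) j ord0 = A ord0 i0.
  rewrite (bigD1 i0) //= big1 => [|j ji]; rewrite mxE ?(negbTE ji) ?mulr0 //.
  by rewrite !eqxx mulr1 addr0.
rewrite divfK //.
have : `|\sum_j A ord0 j * t j ord0| <= 1 + S.
  apply: (@le_trans _ _ S); last by rewrite lerDr.
  apply: le_trans (ler_norm_sum _ _ _) _; apply: ler_sum => j _.
  have /andP[tj0 tj1] := t01 j.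
  by rewrite normrM (ger0_norm tj0) ler_piMr.
set T := \sum_j _ => TS.
have : `|(b - a) / 2 / (1 + S) * T| <= (b - a) / 2.
  rewrite normrM ger0_norm; last by rewrite !divr_ge0 //; lra.
  rewrite -[leRHS]mulr1 -[leLHS]mulrA ler_wpM2l //; first by lra.
  by rewrite mulrC ler_pdivrMr ?mul1r //; lra.
by rewrite ler_norml => /andP[? ?]; apply/andP; split; lra.
Qed.

End affine.

Theorem proposition3 (R : realType) (n : nat) (sigma : R -> R)
    (sigma_mono : weakly_monotone sigma) (sigma_cont : continuous sigma)
    (A : 'M[R]_(1, n)) :
  let f := fun x : 'cV[R]_n => sigma ((A *m x) ord0 ord0) in
  forall p : 'cV[R]_n,
    hausdorff_dim (equiv_class f p) = n%:R%:E \/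
    hausdorff_dim (equiv_class f p) = (n%:R - 1)%:E.
Proof.
move=> f p; have [A0|/existsNP[i0 /eqP Ai0]] := pselect (forall i, A ord0 i = 0).
  left; apply: (@hausdorff_dim_cube _ _ _ 0 1) => // t _.
  rewrite /equiv_class /f /= !row_mul_col.
  by congr sigma; apply: eq_bigr => j _; rewrite A0 !mul0r.
have [[z zp zE]|single] :=
    pselect (exists2 z, z != (A *m p) ord0 ord0 & sigma z = f p); last first.
  right; case: n => [|m] in A f p i0 Ai0 single *; first by case: i0 Ai0.
  rewrite -natr1 addrK -(hausdorff_dim_hyperplane ((A *m p) ord0 ord0) Ai0).
  congr hausdorff_dim; apply/seteqP; split=> x; rewrite /equiv_class /= => xp.
    by apply: contrapT => /eqP nxp; apply: single; exists ((A *m x) ord0 ord0).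
  by rewrite /f xp.
left.
have [a [b [ab ap bp]]] : exists a b, [/\ a < b, sigma a = f p & sigma b = f p].
  case/lt_total/orP: zp => zp; first by exists z, ((A *m p) ord0 ord0).
  by exists ((A *m p) ord0 ord0), z.
have [q [r [r0 qr]]] := slab_contains_cube Ai0 ab.
apply: (hausdorff_dim_cube r0) => t /qr abt; rewrite /equiv_class /= -ap.
by symmetry; exact: weakly_monotone_const (etrans ap (esym bp)) abt.
Qed.
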